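(* Let $\psi\in\Psi$ and put $G(u)=G[\psi](u)=h^*[\psi](\ln u)$ for $u>0$. Assume that there exist constants $\alpha\in(0,1)$ and $K>1$ such that $$G(x/K)\le\alpha\,G(x)\quad\text{for all }x\in(0,\infty).$$ If a random variable $\xi$ satisfies $$T_\xi(y)\le\exp\left(-h^*[\psi](\ln y)\right),\quad y\ge e,$$ then $\xi$ belongs to the Orlicz space $L N[\psi]$, and $$\|\xi\|_{L N[\psi]}\le C(\psi,\alpha,K)<\infty,$$ where the constant $C(\psi,\alpha,K)$ depends only on $\psi,\alpha,K$.
   Context: All random variables are real-valued and defined on a probability space $(\Omega,B,\mathbf{P})$ with expectation $\mathbf{E}$. The tail function is $T_\xi(u)=\max\{\mathbf{P}(\xi>u),\mathbf{P}(\xi<-u)\}$, $u\ge0$. $\Psi$ is the set of continuous functions $\psi:[1,\infty)\to(0,\infty)$ with $\inf_{p\ge1}\psi(p)>0$ such that $h[\psi](p)=p\ln\psi(p)$ is convex on $[1,\infty)$. The Young-Fenchel transform is $h^*[\psi](y)=\sup_{p\in[1,\infty)}(py-h[\psi](p))$. The Young-Orlicz function $N[\psi]$ is $N[\psi](u)=\exp\left(h^*[\psi](\ln|u|)\right)$ for $|u|\ge e$ and $N[\psi](u)=C_0u^2$ for $|u|<e$, where $C_0>0$ is a constant. The Orlicz norm is $\|\xi\|_{L N[\psi]}=\inf\{k>0:\mathbf{E}\,N[\psi](\xi/k)\le1\}$, and $L N[\psi]$ is the space of random variables for which it is finite. *)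

(* Defs.v *)
From HB Require Import structures.
From mathcomp Require Import all_boot all_order all_algebra.
From mathcomp Require Import all_classical all_reals all_analysis.

Set Implicit Arguments.
Unset Strict Implicit.
Unset Printing Implicit Defensive.

Import Order.TTheory GRing.Theory Num.Theory.
Import numFieldNormedType.Exports.

Local Open Scope classical_set_scope.
Local Open Scope ring_scope.

Section YoungOrlicz.
Context {R : realType}.
Implicit Type psi : R -> R.

Definition h_of psi (p : R) : R := p * ln (psi p).

(* Functions on [1, +oo[ are represented by total functions R -> R; only their
   values on [1, +oo[ are ever used. *)
Definition Psi : set (R -> R) := [set psi : R -> R |
  [/\ {within `[1, +oo[%classic, continuous psi},
      (forall p, 1 <= p -> 0 < psi p),
      0 < inf (psi @` `[1, +oo[) &
      convex_function (`[1, +oo[ : set R) (h_of psi)]].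

(* The supremum may be +oo (e.g., when psi is bounded), hence the values in
   the extended reals. *)
Definition hstar psi (y : R) : \bar R :=
  ereal_sup [set (p * y - h_of psi p)%:E | p in `[1, +oo[].

(* Only meaningful for 0 < u. *)
Definition G_of psi (u : R) : \bar R := hstar psi (ln u).

Definition young_orlicz (C0 : R) psi (u : R) : \bar R :=
  if expR 1 <= `|u| then expeR (hstar psi (ln `|u|)) else (C0 * u ^+ 2)%:E.

Context d (T : measurableType d) (P : probability T R).
Implicit Type xi : {RV P >-> R}.

Definition tail xi (u : R) : \bar R :=
  maxe (P [set w | xi w > u]) (P [set w | xi w < - u]).

(* The infimum of the empty set is +oo, so that the norm of a random variable
   outside the Orlicz space is +oo. *)
Definition orlicz_norm (C0 : R) psi xi : \bar R :=
  ereal_inf [set k%:E | k in [set k : R | 0 < k /\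
    (\int[P]_w young_orlicz C0 psi (xi w / k) <= 1)%E]].

Definition orlicz_space (C0 : R) psi : set {RV P >-> R} :=
  [set xi | orlicz_norm C0 psi xi \is a fin_num].

End YoungOrlicz.

(* Main.v *)
Require Import Defs.
From HB Require Import structures.
From mathcomp Require Import all_boot all_order all_algebra.
From mathcomp Require Import all_classical all_reals all_analysis.
From mathcomp Require Import measurable_realfun ring lra.

Set Implicit Arguments.
Unset Strict Implicit.
Unset Printing Implicit Defensive.

Import Order.TTheory GRing.Theory Num.Theory.
Import numFieldNormedType.Exports.

Local Open Scope classical_set_scope.
Local Open Scope ring_scope.

(** Write g for the Young-Fenchel transform h* of h, and L = ln K, so that
    G(exp y) = g y. The growth condition on G says g (y - L) <= alpha * g y.
    Cut the values of |xi| into the geometric shells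
    exp (1 + s L) <= |xi| < exp (1 + (s+1) L), and divide xi by
    k = exp (2 j L), with j >= 2.

    On the shell of index s = j + n, put y = 1 + (s - 1) L. Where
    |xi / k| >= e, the monotonicity of g gives
    N(xi / k) <= exp (g (y - L)) <= exp (alpha * g y), whereas the tail
    hypothesis at exp y bounds the probability of the shell by
    2 exp (- g y). The product is at most 2 exp (- (1 - alpha) g y). Taking
    p = 1 in the supremum that defines g gives g y >= y - h 1, so this decays
    geometrically in s, with ratio r = exp (- (1 - alpha) L) < 1. The strict
    inequality alpha < 1 is exactly what leaves a negative exponent.

    The quadratic branch of N is at most C0 e^2 on these shells, which is
    treated in the same way, and for |xi| < exp (1 + j L) it is at most
    C0 e^2 exp (- 2 j L). Adding up, E N(xi / k) <= D r^j for a constant D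
    that depends only on psi, C0, alpha and K (integral_young_decay). A j
    with D r^j <= 1 bounds the norm by exp (2 j L), for all xi at once.

    Both g and N may be infinite. Where g y = +oo the shell has probability 0,
    and the convention 0 * oo = 0 makes the estimate hold unchanged
    (young_mul_tail_le). *)

(** * The Young-Fenchel transform *)

Lemma le_hstar (R : realType) (psi : R -> R) (y z : R) :
  y <= z -> (hstar psi y <= hstar psi z)%E.
Proof.
move=> yz; apply: ge_ereal_sup => x [p]/=; rewrite in_itv/= andbT => p1 <-.
apply: (@le_trans _ _ (p * z - h_of psi p)%:E).
  by rewrite lee_fin lerD2r ler_wpM2l// (le_trans ler01).
by apply: ereal_sup_ubound; exists p => //=; rewrite in_itv/= p1.
Qed.

(** This affine minorant, from p = 1 in the supremum, is the only lower bound
    on h* that the summation over the shells needs. *)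
Lemma hstar_ge (R : realType) (psi : R -> R) (y : R) :
  ((y - h_of psi 1)%:E <= hstar psi y)%E.
Proof.
by apply: ereal_sup_ubound; exists 1 => /=; rewrite ?in_itv/= ?lexx ?mul1r.
Qed.

(** In the variable y = ln x, division of x by K is a translation. *)
Lemma hstar_shift (R : realType) (psi : R -> R) (alpha K y : R) : 0 < K ->
  (forall x : R, 0 < x -> (G_of psi (x / K) <= alpha%:E * G_of psi x)%E) ->
  (hstar psi (y - ln K) <= alpha%:E * hstar psi y)%E.
Proof.
move=> K0 /(_ _ (expR_gt0 y)); rewrite /G_of.
by rewrite ln_div ?posrE ?expR_gt0// expRK.
Qed.

(** * Series and integrals of nonnegative functions *)

Lemma nneseries_geometric_le (R : realType) (a q : R) :
  0 <= a -> 0 < q < 1 ->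
  (\sum_(n <oo) (a * q ^+ n)%:E <= (a / (1 - q))%:E)%E.
Proof.
move=> a0 /andP[q0 q1]; apply: lime_le.
  by apply: is_cvg_nneseries => n _ _; rewrite lee_fin mulr_ge0// exprn_ge0// ltW.
apply: nearW => n; rewrite sumEFin lee_fin.
by apply: geometric_le_lim => //; rewrite gtr0_norm.
Qed.

(** The integral of a nonnegative function is a supremum over the simple
    functions below it, so that monotonicity holds for arbitrary functions.
    This makes it possible to integrate the Young-Orlicz function without
    showing that it is measurable. *)
Lemma ge0_le_integralT_nonmeasurable d (T : measurableType d) (R : realType)
    (mu : {measure set T -> \bar R}) (f g : T -> \bar R) :
  (forall x, 0 <= f x)%E -> (forall x, f x <= g x)%E ->
  (\int[mu]_x f x <= \int[mu]_x g x)%E.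
Proof.
move=> f0 fg; rewrite !ge0_integralTE//; last by move=> x; exact: le_trans (fg x).
apply: le_ereal_sup => _ [h hf <-]; exists h => // x.
exact: le_trans (hf x) (fg x).
Qed.

(** The function is dominated pointwise by the constant b plus the series of
    the functions c n * 1_(A n), since all of these are nonnegative and one of
    them alone is large enough; the series is integrated term by term. The sets
    may overlap, and the values c n may be infinite. *)
Lemma integral_le_covering d (T : measurableType d) (R : realType)
    (P : probability T R) (f : T -> \bar R) (b : \bar R)
    (A : (set T)^nat) (c : (\bar R)^nat) :
  (forall n, measurable (A n)) -> (forall x, 0 <= f x)%E ->
  (0 <= b)%E -> (forall n, 0 <= c n)%E ->
  (forall x, (f x <= b)%E \/ exists n, A n x /\ (f x <= c n)%E) ->
  (\int[P]_x f x <= b + \sum_(n <oo) c n * P (A n))%E.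
Proof.
move=> mA f0 b0 c0 fcov.
pose g n x := (c n * (\1_(A n) x)%:E)%E.
have g0 n x : (0 <= g n x)%E by rewrite mule_ge0// lee_fin.
have mI n : measurable_fun [set: T] (EFin \o (\1_(A n) : T -> R)).
  exact/measurable_EFinP/measurable_indic.
have mg n : measurable_fun [set: T] (g n) by exact: (measurable_funeM (c n) (@mI n)).
have Ig n : (\int[P]_x g n x = c n * P (A n))%E.
  rewrite (ge0_integralZl P measurableT (@mI n))//.
    by rewrite integral_indic// setIT.
  by move=> x _; rewrite lee_fin.
apply: (@le_trans _ _ (\int[P]_x (b + \sum_(n <oo) g n x)%E)%E); last first.
  rewrite ge0_integralD//; last 2 first.
  - by move=> x _; apply: nneseries_ge0.
  - by apply: ge0_emeasurable_sum => // n x _ _; exact: g0.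
  rewrite integral_cst// [X in (b * X)%E]probability_setT mule1 integral_nneseries//.
  by under eq_eseriesr do rewrite Ig.
apply: ge0_le_integralT_nonmeasurable => // x.
have [fb|[n [Anx fc]]] := fcov x.
  by rewrite (le_trans fb)// leeDl// nneseries_ge0.
rewrite (le_trans fc)//; apply: (@le_trans _ _ (\sum_(m <oo) g m x)%E); last first.
  by rewrite leeDr.
apply: le_trans (nneseries_lim_ge n.+1 _) => //.
rewrite big_nat_recr//= {2}/g indicE mem_set// mule1 leeDr// sume_ge0//.
Qed.

(** * Estimates on the shells *)

(** The gap u < v turns the strict inequalities in the tail function into a
    bound on a closed event. *)
Lemma tail_abs_le d (T : measurableType d) (R : realType)
    (P : probability T R) (xi : {RV P >-> R}) (u v : R) : u < v ->
  (P [set w | (v <= `|xi w|)%R] <= 2%:E * tail xi u)%E.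
Proof.
move=> uv.
have mgt : measurable [set w | xi w > u].
  by rewrite -[X in measurable X]setTI; exact: measurable_fun_ltr.
have mlt : measurable [set w | xi w < - u].
  by rewrite -[X in measurable X]setTI; exact: measurable_fun_ltr.
have mle : measurable [set w | v <= `|xi w|].
  rewrite -[X in measurable X]setTI; apply: measurable_fun_ler => //.
  exact: measurableT_comp.
apply: (@le_trans _ _ (P ([set w | (xi w > u)%R] `|` [set w | (xi w < - u)%R]))).
  apply: le_measure; rewrite ?inE//; first exact: measurableU.
  move=> w /=; have [x0|x0] := ger0P (xi w) => h; [left|right]; lra.
apply: (le_trans (measureU2 _ mgt mlt)).
have -> : (2%:E * tail xi u = tail xi u + tail xi u)%E.
  by rewrite -mule2n -mule_natl.
by rewrite leeD// /tail le_max lexx ?orbT.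
Qed.

(** The first factor bounds the Young-Orlicz function on a shell (c for its
    quadratic branch), the second bounds the probability of the shell. For
    g = +oo the product is +oo * 0 = 0. *)
Lemma young_mul_tail_le (R : realType) (alpha c m : R) (g : \bar R) :
  0 < alpha < 1 -> 0 <= c -> (m%:E <= g)%E ->
  ((c%:E + expeR (alpha%:E * g)) * (2%:E * expeR (- g)) <=
   (2 * c * expR (- m) + 2 * expR (- ((1 - alpha) * m)))%:E)%E.
Proof.
move=> /andP[a0 a1] c0; case: g => [g| |]//=.
- rewrite !lee_fin => mg; rewrite mulrDl.
  have -> : c * (2 * expR (- g)) = 2 * c * expR (- g) by ring.
  have -> : expR (alpha * g) * (2 * expR (- g)) = 2 * expR (- ((1 - alpha) * g)).
    by rewrite mulrCA -expRD; congr (_ * expR _); ring.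
  rewrite lerD// ler_wpM2l ?ler_expR ?lerN2 ?mulr_ge0//.
  by rewrite ler_wpM2l// subr_ge0 ltW.
- by move=> _; rewrite !mule0 lee_fin addr_ge0// !mulr_ge0// expR_ge0.
Qed.

(** The index n is the integer part of (ln y - 1) / L. *)
Lemma exists_exp_shell (R : realType) (L y : R) : 0 < L -> expR 1 <= y ->
  exists n : nat, expR (1 + n%:R * L) <= y < expR (1 + n.+1%:R * L).
Proof.
move=> L0 ey; have y0 : 0 < y by rewrite (lt_le_trans _ ey)// expR_gt0.
have ly : 1 <= ln y by rewrite -ler_expR lnK.
have /truncn_itv/andP[] : 0 <= (ln y - 1) / L by rewrite divr_ge0// ?subr_ge0// ltW.
set n := Num.truncn _; rewrite ler_pdivlMr// ltr_pdivrMr// => h1 h2.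
exists n; rewrite -{1}(@lnK _ y)// -[X in _ && (X < _)](@lnK _ y)// ler_expR ltr_expR.
by apply/andP; split; lra.
Qed.

(** The constant D is chosen before the probability space and the random
    variable, which is what makes the final bound on the norm uniform. *)
Lemma integral_young_decay (R : realType) (C0 : R) (psi : R -> R) (alpha L : R) :
  0 < C0 -> 0 < alpha < 1 -> 0 < L ->
  (forall y, hstar psi (y - L)%R <= alpha%:E * hstar psi y)%E ->
  exists D : R, forall d (T : measurableType d) (P : probability T R)
      (xi : {RV P >-> R}),
    (forall y, (expR 1 <= y)%R -> tail xi y <= expeR (- hstar psi (ln y)))%E ->
    forall j : nat, (2 <= j)%N ->
    (\int[P]_w young_orlicz C0 psi (xi w / expR (2 * j%:R * L)) <=
     (D * expR (- ((1 - alpha) * L)) ^+ j)%:E)%E.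
Proof.
move=> C00 a01 L0 hsh; have /andP[a0 a1] := a01.
pose h1 := h_of psi 1; pose r := expR (- ((1 - alpha) * L)).
pose D := 2 * C0 * expR (1 + h1 + L) + 2 * expR ((1 - alpha) * (h1 - 1 + L)).
exists (C0 * expR 2 + D / (1 - r)) => d T P xi htail j j2; rewrite -/r.
have jR : 2 <= j%:R :> R by rewrite ler_nat.
have D0 : 0 <= D by rewrite addr_ge0// !mulr_ge0 ?expR_ge0// ltW.
have rE n : r ^+ n = expR (- ((1 - alpha) * L * n%:R)).
  by rewrite /r -expRM_natr mulNr.
have r01 : 0 < r < 1.
  by rewrite expR_gt0 expR_lt1 oppr_lt0 mulr_gt0// subr_gt0.
set k := expR (2 * j%:R * L).
have k0 : 0 < k by exact: expR_gt0.
(* The shell of index j + n, which is contained in A n, starts at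
   exp (y n + L): going back by L leaves the strict gap that tail_abs_le
   asks for. *)
pose y n : R := 1 + (j%:R + n%:R - 1) * L.
have y1 n : 1 <= y n.
  have : 0 <= n%:R :> R by [].
  by move=> n0; rewrite lerDl mulr_ge0 ?(ltW L0)//; lra.
pose A n := [set w | expR (1 + (j%:R + n%:R) * L) <= `|xi w|].
pose c n := ((C0 * expR 2)%:E + expeR (alpha%:E * hstar psi (y n)))%E.
have mA n : measurable (A n).
  rewrite -[X in measurable X]setTI; apply: measurable_fun_ler => //.
  exact: measurableT_comp.
have PA n : (P (A n) <= 2%:E * expeR (- hstar psi (y n)))%E.
  have h : expR (y n) < expR (1 + (j%:R + n%:R) * L).
    by rewrite ltr_expR /y; lra.
  have hA : (P (A n) <= 2%:E * tail xi (expR (y n)))%E := tail_abs_le xi h.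
  apply: (le_trans hA).
  rewrite lee_wpmul2l ?lee_fin//.
  by apply: le_trans (htail _ _) _; rewrite ?ler_expR ?y1// expRK.
have c0 n : (0 <= c n)%E.
  by rewrite adde_ge0 ?expeR_ge0// lee_fin mulr_ge0 ?expR_ge0// ltW.
have cPA n : (c n * P (A n) <= ((D * r ^+ j) * r ^+ n)%:E)%E.
  apply: le_trans (lee_wpmul2l (c0 n) (PA n)) _.
  apply: le_trans (young_mul_tail_le a01 _ (hstar_ge psi (y n))) _.
    by rewrite mulr_ge0 ?expR_ge0// ltW.
  rewrite lee_fin -[leRHS]mulrA -exprD rE [leRHS]mulrDl lerD//.
    rewrite -!mulrA !ler_wpM2l ?(ltW C00)// -!expRD ler_expR /y natrD -/h1.
    have : 0 <= alpha * (L * (j%:R + n%:R)) by rewrite !mulr_ge0 ?addr_ge0// ltW.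
    nra.
  rewrite -mulrA ler_wpM2l// -expRD ler_expR /y natrD -/h1.
  lra.
have cover w : (young_orlicz C0 psi (xi w / k) <= (C0 * expR 2 * r ^+ j)%:E)%E \/
    exists n, A n w /\ (young_orlicz C0 psi (xi w / k) <= c n)%E.
  have ak : `|xi w / k| = `|xi w| * expR (- (2 * j%:R * L)).
    by rewrite normrM normfV (gtr0_norm k0) expRN.
  have e2 : expR 2 = expR 1 ^+ 2 :> R by rewrite expr2 -expRD.
  (* Below exp (1 + j L), |xi / k| < exp (1 - j L) < e: only the quadratic
     branch of N occurs. *)
  have [xl|xg] := ltP `|xi w| (expR (1 + j%:R * L)).
    left.
    have small : `|xi w / k| < expR (1 - j%:R * L).
      by rewrite ak -ltr_pdivlMr ?expR_gt0// -expRN -expRD; congr (_ < expR _): xl; ring.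
    have small1 : `|xi w / k| < expR 1.
      by rewrite (lt_le_trans small)// ler_expR gerBl mulr_ge0// ltW.
    rewrite /young_orlicz [expR 1 <= _]leNgt small1 /= lee_fin -mulrA ler_wpM2l ?(ltW C00)//.
    rewrite -real_normK ?num_real// (le_trans (lerXn2r 2 _ _ (ltW small)))
      ?nnegrE ?expR_ge0//.
    rewrite expr2 -expRD rE -expRD ler_expR.
    have : 0 <= alpha * (L * j%:R) by rewrite !mulr_ge0// ltW.
    nra.
  right.
  have e1 : expR 1 <= `|xi w| / expR (j%:R * L).
    by rewrite ler_pdivlMr ?expR_gt0// -expRD.
  have [n /andP[ln un]] := exists_exp_shell L0 e1.
  exists n; split.
    rewrite /A /=; move: ln; rewrite ler_pdivlMr ?expR_gt0// -expRD.
    by congr (expR _ <= _); ring.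
  rewrite /young_orlicz; case: ifPn => [big|]; last first.
    rewrite -ltNge => le; rewrite /c -[leLHS]adde0 leeD ?expeR_ge0// lee_fin.
    rewrite ler_wpM2l ?(ltW C00)// -real_normK ?num_real//.
    by rewrite e2 lerXn2r ?nnegrE ?expR_ge0// ltW.
  rewrite /c -[leLHS]add0e leeD ?lee_fin ?mulr_ge0 ?expR_ge0 ?(ltW C00)//.
  rewrite lee_expeR (le_trans _ (hsh _))// le_hstar//.
  (* ln |xi / k| < 1 + (n + 1 - j) L, and n + 1 - j <= j + n - 2 because
     j >= 2. *)
  rewrite -ler_expR lnK ?posrE//; last first.
    by rewrite (lt_le_trans _ big)// expR_gt0.
  move: un; rewrite ltr_pdivrMr ?expR_gt0// -expRD ak => un.
  rewrite -ler_pdivlMr ?expR_gt0// -expRN -expRD opprK (le_trans (ltW un))//.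
  rewrite ler_expR /y -natr1.
  nra.
have young0 w : (0 <= young_orlicz C0 psi (xi w / k))%E.
  rewrite /young_orlicz; case: ifP => _; rewrite ?expeR_ge0//.
  by rewrite lee_fin mulr_ge0 ?sqr_ge0// ltW.
have b0 : (0 <= (C0 * expR 2 * r ^+ j)%:E)%E.
  by rewrite lee_fin !mulr_ge0 ?expR_ge0// ?exprn_ge0 ?expR_ge0// ltW.
apply: (le_trans (integral_le_covering P mA young0 b0 c0 cover)).
rewrite mulrDl EFinD leeD2l//.
have Dr0 : 0 <= D * r ^+ j by rewrite mulr_ge0// exprn_ge0// expR_ge0.
apply: (@le_trans _ _ (\sum_(n <oo) (D * r ^+ j * r ^+ n)%:E)%E).
  by apply: lee_nneseries => n _; rewrite ?mule_ge0// cPA.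
apply: le_trans (nneseries_geometric_le Dr0 r01) _.
by rewrite lee_fin mulrAC.
Qed.

Theorem proposition5p2 (R : realType) (C0 : R) (hC0 : 0 < C0)
    (psi : R -> R) (hpsi : Psi psi) (alpha K : R)
    (halpha : 0 < alpha < 1) (hK : 1 < K)
    (hG : forall x : R, 0 < x ->
       (G_of psi (x / K) <= alpha%:E * G_of psi x)%E) :
  exists C : R,
    forall (d : measure_display) (T : measurableType d) (P : probability T R)
      (xi : {RV P >-> R}),
      (forall y : R, expR 1 <= y ->
         (tail xi y <= expeR (- hstar psi (ln y)))%E) ->
      orlicz_space C0 psi xi /\ (orlicz_norm C0 psi xi <= C%:E)%E.
Proof.
have K0 : 0 < K by exact: lt_trans hK.
have L0 : 0 < ln K by exact: ln_gt0.
have hsh y := hstar_shift y K0 hG.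
have [D int_le] := integral_young_decay hC0 halpha L0 hsh.
set r := expR (- _) in int_le.
have r1 : `|r| < 1.
  rewrite ger0_norm ?expR_ge0// /r expR_lt1 oppr_lt0 mulr_gt0// subr_gt0.
  by case/andP: halpha.
have [j [j2 Dr1]] : exists j, (2 <= j)%N /\ D * r ^+ j <= 1.
  have : D * r ^+ n @[n --> \oo] --> D * 0 by apply: cvgMr; exact: cvg_expr.
  rewrite mulr0 => /cvgr_le/(_ _ ltr01)[N _ HN].
  by exists (maxn 2 N); split; [exact: leq_maxl|apply: HN; exact: leq_maxr].
exists (expR (2 * j%:R * ln K)) => d T P xi htail.
have nle : (orlicz_norm C0 psi xi <= (expR (2 * j%:R * ln K))%:E)%E.
  apply: ereal_inf_lbound; exists (expR (2 * j%:R * ln K)) => //=.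
  split; first exact: expR_gt0.
  by rewrite (le_trans (int_le _ _ _ _ htail _ j2)).
have nge : (0 <= orlicz_norm C0 psi xi)%E.
  by apply: le_ereal_inf_tmp => _ [k [k0 _] <-]; rewrite lee_fin ltW.
split=> //; rewrite /orlicz_space /= ge0_fin_numE//.
by rewrite (le_lt_trans nle)// ltry.
Qed.
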